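(* Let $V=\{1,\dots,n\}$ and let $\lambda=(\lambda_1,\dots,\lambda_k)$ be integers with $0<\lambda_1<\lambda_2<\cdots<\lambda_k\le n$. Let $\mathcal H(\lambda)=\bigcup_{j=1}^k\binom{V}{\lambda_j}$, where $\binom{V}{t}$ denotes the family of all $t$-element subsets of $V$. Then $\mathcal H(\lambda)$ is minimal transversal-free if and only if (i) $\lambda_{i+1}-\lambda_i\le\lambda_1$ for all $i=1,\dots,k-1$, and (ii) $\lambda_1+\lambda_k=n$.
   Context: For a hypergraph $\mathcal H\subseteq 2^V$: a set $T\subseteq V$ is a transversal if $T\cap H\neq\emptyset$ for all $H\in\mathcal H$; $\mathcal H$ is transversal-free if no hyperedge $H\in\mathcal H$ is a transversal of $\mathcal H$. For $S\subseteq V$, $\mathcal H_S=\{H\in\mathcal H: H\subseteq S\}$. $\mathcal H$ is minimal transversal-free if it is transversal-free and every nonempty proper induced subhypergraph $\mathcal H_S$ ($S\subsetneq V$, $\mathcal H_S\neq\emptyset$) is not transversal-free. *)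

(* Defs.v *)
From mathcomp Require Import all_boot.

Set Implicit Arguments.
Unset Strict Implicit.
Unset Printing Implicit Defensive.

Section Hypergraph.
Variable V : finType.
Implicit Types (E : {set {set V}}) (S T : {set V}).

Definition transversal E T : Prop :=
  forall H : {set V}, H \in E -> T :&: H != set0.

Definition transversal_free E : Prop :=
  forall H : {set V}, H \in E -> ~ transversal E H.

Definition induced E S : {set {set V}} := [set H in E | H \subset S].

Definition minimal_transversal_free E : Prop :=
  transversal_free E /\
  forall S, S \proper [set: V] -> induced E S != set0 ->
    ~ transversal_free (induced E S).

Definition subsets_of_card (t : nat) : {set {set V}} :=
  [set A : {set V} | #|A| == t].

End Hypergraph.

(* The ground set {1, ..., n} is modelled by 'I_n. The sequence lam has
   k.+1 >= 1 terms, lam ord0 being the first and lam ord_max the last. *)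
Definition symmetric_hypergraph (n k : nat) (lam : 'I_k.+1 -> nat) :
    {set {set 'I_n}} :=
  \bigcup_(j < k.+1) subsets_of_card 'I_n (lam j).

(* Main.v *)
Require Import Defs.
From mathcomp Require Import all_boot.
From mathcomp Require Import zify.

(** All subsets of a given size have isomorphic induced subhypergraphs, so
    everything is decided by m = #|S|. An edge H contained in S is a transversal
    of the subhypergraph induced on S iff S :\: H contains no edge, i.e. iff
    m - #|H| < lam_1. Hence that subhypergraph is transversal-free iff
    lam_1 + lam_j <= m whenever lam_j <= m, and it fails to be so exactly for
    those m >= lam_1 lying in one of the windows [lam_j, lam_j + lam_1).
    Minimality says that n is beyond the last window and that the windows cover
    [lam_1, n). *)

Lemma exists_subset_of_card {T : finType} {A : {set T}} {m : nat} :
  m <= #|A| -> exists2 B : {set T}, B \subset A & #|B| = m.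
Proof.
move=> /card_geqP [s [s_uniq <- sA]]; exists [set x in s].
  by apply/subsetP => x; rewrite inE => /sA.
by rewrite cardsE; apply/card_uniqP.
Qed.

Lemma induced_setT (V : finType) (E : {set {set V}}) : induced E [set: V] = E.
Proof. by apply/setP => A; rewrite inE subsetT andbT. Qed.

Section Symmetric.

Context (n : nat) {k : nat} {lam : 'I_k.+1 -> nat}.
Hypothesis lam_incr : forall i j : 'I_k.+1, i < j -> lam i < lam j.

Lemma lam_le {i j : 'I_k.+1} : i <= j -> lam i <= lam j.
Proof.
by rewrite leq_eqVlt => /orP [/eqP/val_inj -> //|/lam_incr/ltnW].
Qed.

Lemma symmetric_hypergraphP (A : {set 'I_n}) :
  reflect (exists j, #|A| = lam j) (A \in symmetric_hypergraph n lam).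
Proof.
apply: (iffP bigcupP) => [[j _]|[j Aj]]; first by rewrite inE => /eqP; exists j.
by exists j => //; rewrite inE Aj.
Qed.

Lemma induced_neq0 (S : {set 'I_n}) :
  (induced (symmetric_hypergraph n lam) S != set0) = (lam ord0 <= #|S|).
Proof.
apply/set0Pn/idP => [[A]|/exists_subset_of_card [A AS cardA]].
  rewrite inE => /andP [/symmetric_hypergraphP [j Aj] /subset_leq_card].
  by rewrite Aj; apply: leq_trans; apply: lam_le.
exists A; rewrite inE AS andbT.
by apply/symmetric_hypergraphP; exists ord0.
Qed.

Lemma transversal_free_inducedP (S : {set 'I_n}) :
  transversal_free (induced (symmetric_hypergraph n lam) S) <->
  (forall j, lam j <= #|S| -> lam ord0 + lam j <= #|S|).
Proof.
split=> [tfS j lejS | windows H].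
  rewrite leqNgt; apply/negP => ltS.
  have [A AS cardA] := exists_subset_of_card lejS.
  have AE : A \in induced (symmetric_hypergraph n lam) S.
    by rewrite inE AS andbT; apply/symmetric_hypergraphP; exists j.
  apply: (tfS _ AE) => B; rewrite inE => /andP [/symmetric_hypergraphP [i Bi] BS].
  apply/eqP => AB0.
  (* Two disjoint edges [A] and [B] would need at least [lam j + lam ord0] points of [S], more than
     it has. *)
  have: #|A :|: B| <= #|S| by apply: subset_leq_card; rewrite subUset AS.
  have := lam_le (leq0n i : (ord0 : 'I_k.+1) <= i).
  by rewrite cardsU AB0 cards0; lia.
rewrite inE => /andP [/symmetric_hypergraphP [j Hj] HS] trH.
have leHS := subset_leq_card HS.
have := windows j; rewrite -Hj => /(_ leHS) le0.
(* Outside [H] there is room in [S] for an edge of the smallest size, which [H] then misses. *)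
have le0D : lam ord0 <= #|S :\: H|.
  by rewrite cardsD (setIidPr HS); lia.
have [B BD cardB] := exists_subset_of_card le0D.
have BE : B \in induced (symmetric_hypergraph n lam) S.
  rewrite inE (subset_trans BD (subsetDl _ _)) andbT.
  by apply/symmetric_hypergraphP; exists ord0.
have /negP := trH _ BE; apply.
by rewrite setI_eq0 disjoint_sym; move: BD; rewrite subsetD => /andP [].
Qed.

Lemma minimal_transversal_freeP :
  minimal_transversal_free (symmetric_hypergraph n lam) <->
  (forall j, lam j <= n -> lam ord0 + lam j <= n) /\
  (forall m, lam ord0 <= m < n -> exists j, lam j <= m < lam ord0 + lam j).
Proof.
(* Seen as induced on the full vertex set, the hypergraph itself falls under the same criterion,
   with size [n]. *)
rewrite /minimal_transversal_free -{1}[symmetric_hypergraph n lam]induced_setT.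
rewrite transversal_free_inducedP cardsT card_ord.
split=> -[tf minl]; split=> //.
  move=> m /andP [le0m ltmn].
  have lem : m <= #|[set: 'I_n]| by rewrite cardsT card_ord ltnW.
  have [S _ Sm] := exists_subset_of_card lem.
  have SP : S \proper [set: 'I_n].
    by rewrite properEcard subsetT cardsT card_ord Sm.
  have S0 : induced (symmetric_hypergraph n lam) S != set0.
    by rewrite induced_neq0 Sm.
  case: (boolP [exists j, lam j <= m < lam ord0 + lam j]) => [/existsP //|].
  move=> /existsPn noj; case: (minl S SP S0).
  apply/transversal_free_inducedP => j; rewrite Sm => lej.
  by have := noj j; rewrite lej -leqNgt.
move=> S /proper_card; rewrite cardsT card_ord induced_neq0 => ltS le0S.
have [|j /andP [lej gtj]] := minl #|S|; first by rewrite le0S.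
by move=> /transversal_free_inducedP /(_ j lej); rewrite leqNgt gtj.
Qed.

End Symmetric.

Theorem theorem2 (n k : nat) (lam : 'I_k.+1 -> nat)
    (lam_gt0 : 0 < lam ord0)
    (lam_incr : forall i j : 'I_k.+1, i < j -> lam i < lam j)
    (lam_len : lam ord_max <= n) :
  minimal_transversal_free (symmetric_hypergraph n lam) <->
  (forall i j : 'I_k.+1, j = i.+1 :> nat -> lam j - lam i <= lam ord0) /\
  lam ord0 + lam ord_max = n.
Proof.
have le_max j : lam j <= lam ord_max by apply: lam_le => //; rewrite -ltnS.
rewrite minimal_transversal_freeP //; split=> [[tf cover]|[gaps sum_n]].
  have le_n := tf _ lam_len; split=> [i j ji|].
    rewrite leqNgt; apply/negP => gap.
    (* This is the first size past the window of [i]; too large a gap puts it before the window of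
       [j], so nothing covers it. *)
    have [|h /andP [leh gth]] := cover (lam i + lam ord0).
      by have := le_max j; lia.
    have [lehi|ltih] := leqP h i; first by have := lam_le lam_incr lehi; lia.
    have lejh : j <= h by rewrite ji.
    by have := lam_le lam_incr lejh; lia.
  apply/eqP; rewrite eqn_leq le_n leqNgt; apply/negP => ltn.
  (* This is the first size past the last window, so it cannot lie below [n]. *)
  have [|h /andP [_ gth]] := cover (lam ord0 + lam ord_max); first by lia.
  by have := le_max h; lia.
split=> [j _|m /andP [le0m ltmn]]; first by have := le_max j; lia.
(* The window covering m is that of the last lam_j <= m. *)
case: (@arg_maxnP _ ord0 (fun j => lam j <= m) val le0m) => j lej maxj.
exists j; rewrite lej /=.
(* The last window ends exactly at [n]. *)
have [jk|] := eqVneq j ord_max; first by rewrite jk sum_n.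
rewrite -val_eqE /= => jk.
have ltj : j.+1 < k.+1 by have := ltn_ord j; lia.
(* By maximality of [j] the next term exceeds [m], and the gap bound keeps that term within
   [lam ord0 + lam j]. *)
have := gaps j (Ordinal ltj) erefl.
have [/maxj /=|] := leqP (lam (Ordinal ltj)) m; lia.
Qed.
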